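(* Let $T$ be a complete theory with monster model $\mathbb{M}$, and let $\mathop{\smile\!\!\!\!\!\mid}$ be a ternary relation between small sets (or tuples) of $\mathbb{M}$ which is invariant under automorphisms of $\mathbb{M}$ and satisfies: (Symmetry) $a\mathop{\smile\!\!\!\!\!\mid}_C b$ iff $b\mathop{\smile\!\!\!\!\!\mid}_C a$; (Full existence) for all $a,b,C$ there is $a'\equiv_C a$ with $a'\mathop{\smile\!\!\!\!\!\mid}_C b$; (Weak transitivity over models) for every small $M\preceq\mathbb{M}$: if $a\mathop{\smile\!\!\!\!\!\mid}_{M d} b$, $a\mathop{\smile\!\!\!\!\!\mid}^h_M d$ and $b\mathop{\smile\!\!\!\!\!\mid}^u_M d$, then $a\mathop{\smile\!\!\!\!\!\mid}_M b$; (Weak independence theorem over models) for every small $M\preceq\mathbb{M}$: if $c_1\equiv_M c_2$, $c_1\mathop{\smile\!\!\!\!\!\mid}^h_M a$, $c_2\mathop{\smile\!\!\!\!\!\mid}^u_M b$ and $a\mathop{\smile\!\!\!\!\!\mid}_M b$, then there is $c$ with $c\equiv_{Ma}c_1$ and $c\equiv_{Mb}c_2$. Then $T$ is NSOP$_4$.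
   Context: For a small set $E$ and tuples $a,b$: $a\mathop{\smile\!\!\!\!\!\mid}^u_E b$ means $\mathrm{tp}(a/bE)$ is finitely satisfiable in $E$, and $a\mathop{\smile\!\!\!\!\!\mid}^h_E b$ means $b\mathop{\smile\!\!\!\!\!\mid}^u_E a$. The subscript $Md$ denotes $M\cup d$. For $n\ge3$, a theory has SOP$_n$ if there are a type $p(x,y)$ and an indiscernible sequence $(a_i)_{i<\omega}$ with $(a_i,a_j)\models p$ iff $i<j$, such that $p(x_0,x_1)\cup p(x_1,x_2)\cup\dots\cup p(x_{n-2},x_{n-1})\cup p(x_{n-1},x_0)$ is inconsistent; NSOP$_n$ means not SOP$_n$. *)

(* Defs.v *)
From mathcomp Require Import all_boot.
From mathcomp Require Import boolp classical_sets functions cardinality.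

Set Implicit Arguments.
Unset Strict Implicit.
Unset Printing Implicit Defensive.

Local Open Scope classical_set_scope.

Record language := Language {
  fsym : Type;
  rsym : Type;
  farity : fsym -> nat;
  rarity : rsym -> nat }.

(* A formula over V has its free variables in the type V, which may be
   infinite. The quantifier binds the variable None of option V. *)
Inductive term (L : language) (V : Type) : Type :=
| Var of V
| App (f : fsym L) of ('I_(farity f) -> term L V).

Inductive formula (L : language) (V : Type) : Type :=
| FFalse
| FEq of term L V & term L V
| FRel (r : rsym L) of ('I_(rarity r) -> term L V)
| FImp of formula L V & formula L V
| FAll of formula L (option V).

Arguments FFalse {L V}.

Definition FNot L (V : Type) (phi : formula L V) : formula L V :=
  FImp phi FFalse.

Record structure (L : language) := Structure {
  carrier :> Type;
  carrier_inhabited : inhabited carrier;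
  finterp : forall f : fsym L, ('I_(farity f) -> carrier) -> carrier;
  rinterp : forall r : rsym L, ('I_(rarity r) -> carrier) -> Prop }.

Fixpoint tval L (M : structure L) (V : Type) (e : V -> M) (t : term L V) : M :=
  match t with
  | Var v => e v
  | App f ts => finterp (fun i => tval e (ts i))
  end.

Definition scons (T V : Type) (x : T) (e : V -> T) (v : option V) : T :=
  if v is Some w then e w else x.

Fixpoint sat L (M : structure L) (V : Type) (phi : formula L V) :
    (V -> M) -> Prop :=
  match phi with
  | FFalse => fun _ => False
  | FEq s t => fun e => tval e s = tval e t
  | FRel r ts => fun e => rinterp (fun i => tval e (ts i))
  | FImp phi1 phi2 => fun e => sat phi1 e -> sat phi2 e
  | FAll phi1 => fun e => forall x : M, sat phi1 (scons x e)
  end.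

Definition sentence (L : language) := formula L void.

Definition models L (N : structure L) (T : set (sentence L)) : Prop :=
  forall phi, T phi -> sat phi (of_void N).

Definition entails L (T : set (sentence L)) (phi : sentence L) : Prop :=
  forall N : structure L, models N T -> sat phi (of_void N).

Definition complete_theory L (T : set (sentence L)) : Prop :=
  (exists N : structure L, models N T) /\
  (forall phi, entails T phi \/ entails T (FNot phi)).

Definition automorphism L (M : structure L) (s : M -> M) : Prop :=
  [/\ bijective s,
      forall (f : fsym L) (x : 'I_(farity f) -> M),
        s (finterp x) = finterp (s \o x)
    & forall (r : rsym L) (x : 'I_(rarity r) -> M),
        rinterp x <-> rinterp (s \o x)].

Definition elementary_embedding L (N M : structure L) (f : N -> M) : Prop :=
  forall (phi : formula L nat) (e : nat -> N), sat phi e <-> sat phi (f \o e).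

Definition fclosed L (M : structure L) (E : set M) : Prop :=
  forall (f : fsym L) (x : 'I_(farity f) -> M),
    (forall i, E (x i)) -> E (finterp x).

Definition substructure L (M : structure L) (E : set M)
    (E0 : inhabited E) (clE : fclosed E) : structure L :=
  @Structure L (set_type E) E0
    (fun f (x : 'I_(farity f) -> E) =>
       exist _ (finterp (fun i => val (x i)))
         (mem_set (clE f _ (fun i => set_valP (x i)))))
    (fun r (x : 'I_(rarity r) -> E) => rinterp (fun i => val (x i))).

(* E is the underlying set of an elementary substructure of M. *)
Definition elementary_sub L (M : structure L) (E : set M) : Prop :=
  exists (E0 : inhabited E) (clE : fclosed E),
    @elementary_embedding L (substructure E0 clE) M
      (fun x : E => val x).

(* A tuple of M is a function a : I -> M for some index type I. In a type over
   a set C, the variables are indexed by I and the parameters are the elements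
   of C, seen as the right summand of I + C. *)
Definition join (T I J : Type) (a : I -> T) (b : J -> T) (z : I + J) : T :=
  match z with inl i => a i | inr j => b j end.

Definition with_params L (M : structure L) (I : Type) (C : set M)
    (a : I -> M) : (I + C)%type -> M :=
  join a (fun c : C => val c).
Arguments with_params {L M I} C a _.

Definition tp L (M : structure L) (I : Type) (a : I -> M) (C : set M) :
    set (formula L (I + C)%type) :=
  [set phi | sat phi (with_params C a)].
Arguments tp {L M I} a C _.

Definition equiv_over L (M : structure L) (C : set M) (I : Type)
    (a b : I -> M) : Prop :=
  tp a C = tp b C.

Definition finitely_satisfiable_in L (M : structure L) (I : Type)
    (C E : set M) (p : set (formula L (I + C)%type)) : Prop :=
  forall q, finite_set q -> q `<=` p ->
    exists e : I -> M, (forall i, E (e i)) /\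
      (forall phi, q phi -> sat phi (with_params C e)).

Definition ind_u L (M : structure L) (E : set M) (I J : Type)
    (a : I -> M) (b : J -> M) : Prop :=
  finitely_satisfiable_in E (tp a (range b `|` E)).

Definition ind_h L (M : structure L) (E : set M) (I J : Type)
    (a : I -> M) (b : J -> M) : Prop :=
  ind_u E b a.

(* A cardinal is given by a type K of that cardinality. *)
Definition card_lt (T U : Type) (A : set T) (B : set U) : Prop :=
  (A #<= B)%card /\ ~ (B #<= A)%card.

Definition small (K T : Type) (A : set T) : Prop := card_lt A [set: K].

Definition small_type (K I : Type) : Prop := small K [set: I].

Definition saturated (K : Type) L (M : structure L) : Prop :=
  forall (C : set M) (p : set (formula L (unit + C)%type)), small K C ->
    finitely_satisfiable_in setT p ->
    exists a : unit -> M, forall phi, p phi -> sat phi (with_params C a).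

Definition strongly_homogeneous (K : Type) L (M : structure L) : Prop :=
  forall (I : Type) (a b : I -> M), small_type K I -> equiv_over set0 a b ->
    exists2 s, automorphism s & s \o a = b.

(* The cardinal K is larger than the number |L| + aleph_0 of L-formulas. *)
Definition monster (K : Type) L (M : structure L) : Prop :=
  [/\ small_type K (formula L nat), saturated K M & strongly_homogeneous K M].

(* The sides of the relation are tuples and its base is a set. A relation
   between sets is the special case in which only the ranges of the tuples
   matter. *)
Definition ternary_relation L (M : structure L) : Type :=
  forall I J : Type, (I -> M) -> set M -> (J -> M) -> Prop.

Section Relation.
Variables (K : Type) (L : language) (M : structure L).
Variable ind : ternary_relation M.

Definition invariant_rel : Prop :=
  forall (s : M -> M) (I J : Type) (a : I -> M) (C : set M) (b : J -> M),
    automorphism s -> small_type K I -> small_type K J -> small K C ->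
    ind a C b <-> ind (s \o a) (s @` C) (s \o b).

Definition symmetry : Prop :=
  forall (I J : Type) (a : I -> M) (C : set M) (b : J -> M),
    small_type K I -> small_type K J -> small K C ->
    ind a C b <-> ind b C a.

Definition full_existence : Prop :=
  forall (I J : Type) (a : I -> M) (C : set M) (b : J -> M),
    small_type K I -> small_type K J -> small K C ->
    exists a' : I -> M, equiv_over C a' a /\ ind a' C b.

Definition weak_transitivity : Prop :=
  forall (E : set M) (I J D : Type) (a : I -> M) (b : J -> M) (d : D -> M),
    small K E -> elementary_sub E ->
    small_type K I -> small_type K J -> small_type K D ->
    ind a (E `|` range d) b -> ind_h E a d -> ind_u E b d ->
    ind a E b.

Definition weak_independence : Prop :=
  forall (E : set M) (I J J' : Type)
    (c1 c2 : I -> M) (a : J -> M) (b : J' -> M),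
    small K E -> elementary_sub E ->
    small_type K I -> small_type K J -> small_type K J' ->
    equiv_over E c1 c2 -> ind_h E c1 a -> ind_u E c2 b -> ind a E b ->
    exists c : I -> M, equiv_over (E `|` range a) c c1 /\
      equiv_over (E `|` range b) c c2.

End Relation.

Definition realizes L (N : structure L) (I : Type)
    (p : set (formula L (I + I)%type)) (a b : I -> N) : Prop :=
  forall phi, p phi -> sat phi (join a b).

Definition indiscernible L (N : structure L) (I : Type)
    (a : nat -> I -> N) : Prop :=
  forall (n : nat) (f g : 'I_n -> nat),
    {homo f : i j / i < j} -> {homo g : i j / i < j} ->
    forall phi : formula L ('I_n * I)%type,
      sat phi (fun z => a (f z.1) z.2) <-> sat phi (fun z => a (g z.1) z.2).

(* Meant for n >= 3. As ordS is the cyclic successor of 'I_n, the last clause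
   says that no model of T realizes p(x_0,x_1), ..., p(x_{n-2},x_{n-1}),
   p(x_{n-1},x_0). *)
Definition SOP (n : nat) L (T : set (sentence L)) : Prop :=
  exists (I : Type) (p : set (formula L (I + I)%type))
    (N : structure L) (a : nat -> I -> N),
    [/\ models N T,
        indiscernible a,
        forall i j, realizes p (a i) (a j) <-> i < j
      & ~ exists (N' : structure L) (b : 'I_n -> I -> N'),
          models N' T /\ forall i, realizes p (b i) (b (ordS i))].

Definition NSOP (n : nat) L (T : set (sentence L)) : Prop := ~ SOP n T.

(* Main.v *)
(* Let phi be a finite part of p without 4-cycles. A coheir of tp(a_i) over a
   small elementary E containing the whole sequence is realized by b0, then by
   b1 over E and b0, so that b1 is u-independent from b0 over E, has the same
   type over E, and phi(b1,b0) holds. Write x -> y when (x,y) has the type of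
   (b0,b1) over E. Choose b with b1 -> b, then by full existence a of the type
   of b0 over E and b1 with a independent from b over E and b1. As
   a -> b1 -> b, weak transitivity makes a and b independent over E, and the
   weak independence theorem applied to c1 -> a and b -> c2 gives c with
   b -> c -> a: a 4-cycle. Types are realized one element at a time by
   saturation, transferring them from another structure of the same theory,
   such as an ultrapower for the coheir. *)

Require Import Defs.
From mathcomp Require Import all_boot.
From mathcomp Require Import boolp classical_sets functions cardinality.
From mathcomp Require Import filter.

Set Implicit Arguments.
Unset Strict Implicit.
Unset Printing Implicit Defensive.

Local Open Scope classical_set_scope.

(** * Renaming and finiteness of support *)

Fixpoint rename_term L (V W : Type) (r : V -> W) (t : term L V) : term L W :=
  match t with
  | Var v => Var L (r v)
  | App f ts => App (fun i => rename_term r (ts i))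
  end.

Fixpoint rename L (V W : Type) (r : V -> W) (phi : formula L V) :
    formula L W :=
  match phi with
  | FFalse => FFalse
  | FEq s t => FEq (rename_term r s) (rename_term r t)
  | FRel R ts => FRel (fun i => rename_term r (ts i))
  | FImp phi1 phi2 => FImp (rename r phi1) (rename r phi2)
  | FAll phi1 => FAll (rename (omap r) phi1)
  end.

Lemma tval_rename L (M : structure L) V W (r : V -> W) (t : term L V)
    (e : W -> M) : Defs.tval e (rename_term r t) = Defs.tval (e \o r) t.
Proof.
by elim: t => //= f ts IH; congr finterp; apply: funext => i; rewrite IH.
Qed.

Lemma scons_omap (T V W : Type) (r : V -> W) (x : T) (e : W -> T) :
  scons x e \o omap r = scons x (e \o r).
Proof. by apply: funext; case. Qed.

Lemma sat_rename L (M : structure L) V W (r : V -> W) (phi : formula L V)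
    (e : W -> M) : sat (rename r phi) e <-> sat phi (e \o r).
Proof.
elim: phi W r e => {V} [V|V s t|V R ts|V phi1 IH1 phi2 IH2|V phi IH] W r e //=.
- by rewrite !tval_rename.
- by under [X in rinterp X]funext do rewrite tval_rename.
- by rewrite IH1 IH2.
- by split=> h x; [rewrite -scons_omap -IH|rewrite IH scons_omap].
Qed.

Definition FAnd L V (phi psi : formula L V) : formula L V :=
  FNot (FImp phi (FNot psi)).

Definition FEx L V (phi : formula L (option V)) : formula L V :=
  FNot (FAll (FNot phi)).

Lemma sat_and L (M : structure L) V (phi psi : formula L V) (e : V -> M) :
  sat (FAnd phi psi) e <-> sat phi e /\ sat psi e.
Proof.
split=> /= [h|[h1 h2]]; last by apply.
by split; apply: contrapT => n; apply: h => // ? ?.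
Qed.

Lemma sat_ex L (M : structure L) V (phi : formula L (option V)) (e : V -> M) :
  sat (FEx phi) e <-> exists x, sat phi (scons x e).
Proof.
split=> /= [h|[x hx]]; last by move/(_ x).
by apply: contrapT => /forallNP n; apply: h.
Qed.

(** One formula serves all structures, so a finite part of a type can be carried from one structure
    to another. *)
Lemma finite_conj L V (q : set (formula L V)) : finite_set q ->
  exists psi : formula L V, forall (M : structure L) (e : V -> M),
    sat psi e <-> forall phi, q phi -> sat phi e.
Proof.
move=> /(@finite_seqP {classic formula L V}) [s ->].
elim: s => [|phi s [psi IH]].
  by exists (FImp FFalse FFalse) => M e; split=> // _ phi.
exists (FAnd phi psi) => M e; rewrite sat_and IH; split.
  by move=> [h1 h2] theta /=; rewrite inE => /orP[/eqP->|/h2].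
move=> h; split; first by apply: h; rewrite /= inE eqxx.
by move=> theta hs; apply: h; rewrite /= inE hs orbT.
Qed.

Lemma term_support L V (t : term L V) :
  exists2 A : set V, finite_set A & forall (M : structure L) (e e' : V -> M),
    {in A, e =1 e'} -> Defs.tval e t = Defs.tval e' t.
Proof.
elim: t => [v|f ts IH].
  exists [set v]; first exact: finite_set1.
  by move=> M e e' h; apply: h; rewrite inE.
have [A hA] := choice (fun i => (exists2P _ _).1 (IH i)).
exists (\bigcup_(i in setT) A i).
  by apply: bigcup_finite => // i _; have [] := hA i.
move=> M e e' h /=; congr finterp; apply: funext => i; apply: (hA i).2.
by move=> v; rewrite inE => hv; apply: h; rewrite inE; exists i.
Qed.

Lemma formula_support L V (phi : formula L V) :
  exists2 A : set V, finite_set A & forall (M : structure L) (e e' : V -> M),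
    {in A, e =1 e'} -> sat phi e <-> sat phi e'.
Proof.
elim: phi => {V} [V|V s t|V R ts|V phi [A fA hA] psi [B fB hB]|V phi [A fA hA]].
- by exists set0.
- have [A fA hA] := term_support s; have [B fB hB] := term_support t.
  exists (A `|` B); first by rewrite finite_setU.
  move=> M e e' h /=.
  by rewrite (hA M e e') ?(hB M e e') // => v; rewrite inE => hv; apply: h;
    rewrite inE; [right|left].
- have [A hA] := choice (fun i => (exists2P _ _).1 (term_support (ts i))).
  exists (\bigcup_(i in setT) A i).
    by apply: bigcup_finite => // i _; have [] := hA i.
  move=> M e e' h /=.
  suff -> : (fun i => Defs.tval e (ts i)) = (fun i => Defs.tval e' (ts i)).
    by [].
  apply: funext => i; apply: (hA i).2.
  by move=> v; rewrite inE => hv; apply: h; rewrite inE; exists i.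
- exists (A `|` B); first by rewrite finite_setU.
  move=> M e e' h /=.
  by rewrite (hA M e e') ?(hB M e e') // => v; rewrite inE => hv; apply: h;
    rewrite inE; [right|left].
- exists (Some @^-1` A).
    by apply: finite_preimage fA => x y _ _ [].
  move=> M e e' h /=.
  have E x : {in A, scons x e =1 scons x e'}.
    by move=> [v|] //; rewrite inE => hv; apply: h; rewrite inE.
  by split=> hx x; [rewrite -(hA M _ _ (E x))|rewrite (hA M _ _ (E x))].
Qed.

Lemma finite_bound (A : set nat) : finite_set A ->
  exists n, forall k, A k -> k < n.
Proof.
move=> /finite_seqP [s ->]; exists (\max_(k <- s) k).+1 => k /= ks.
by rewrite ltnS; apply: leq_bigmax_seq.
Qed.

Lemma finite_inj_nat V (A : set V) : finite_set A ->
  exists w : V -> nat, {in A &, injective w}.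
Proof.
move=> /finite_set_countable /pcard_injP [f fi].
by exists f => x y; rewrite !inE => Ax Ay; apply: fi; rewrite inE.
Qed.

(** In use, [A] holds the finitely many variables of a formula, which [w] numbers. The last clause
    keeps the new tuple inside any set containing [x0] and the old entries. *)
Lemma extend_along (T V W : Type) (A : set V) (w : V -> W) (x0 : T)
    (e : V -> T) : {in A &, injective w} ->
  exists e' : W -> T, {in A, e =1 e' \o w} /\
    forall k, e' k = x0 \/ exists v, e' k = e v.
Proof.
move=> wi.
have H k : exists y, (forall v, A v -> w v = k -> y = e v) /\
    (y = x0 \/ exists v, y = e v).
  have [[v [Av vk]]|n] := pselect (exists v, A v /\ w v = k).
    exists (e v); split; last by right; exists v.
    move=> v' Av' vk'; congr e; apply: wi; rewrite ?inE //.
    by rewrite vk vk'.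
  exists x0; split; last by left.
  by move=> v Av vk; case: n; exists v.
have [e' h'] := choice H; exists e'; split=> [v|k]; last by have [] := h' k.
by rewrite inE => Av /=; have [/(_ v Av erefl) ->] := h' (w v).
Qed.

(** The tuples may live in different structures; for [V] empty this is elementary equivalence. *)
Definition same_tp L (N N' : structure L) V (e : V -> N) (e' : V -> N') :
    Prop :=
  forall phi : formula L V, sat phi e <-> sat phi e'.

Lemma same_tp_comp L (N N' : structure L) V W (r : W -> V)
    (e : V -> N) (e' : V -> N') : same_tp e e' -> same_tp (e \o r) (e' \o r).
Proof.
by move=> h phi; have := h (rename r phi); rewrite !(sat_rename r).
Qed.

Lemma same_tp_sym L (N N' : structure L) V (e : V -> N) (e' : V -> N') :
  same_tp e e' -> same_tp e' e.
Proof. by move=> h phi; rewrite h. Qed.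

Lemma same_tp_trans L (N N' N'' : structure L) V (e : V -> N) (e' : V -> N')
  (e'' : V -> N'') : same_tp e e' -> same_tp e' e'' -> same_tp e e''.
Proof. by move=> h h' phi; rewrite h h'. Qed.

Lemma same_tp_eq L (N N' : structure L) V (e : V -> N) (e' : V -> N') x y :
  same_tp e e' -> e x = e y -> e' x = e' y.
Proof. by move=> /(_ (FEq (Var L x) (Var L y))) /=[h _]. Qed.

Lemma equiv_overP L (M : structure L) (C : set M) I (a b : I -> M) :
  equiv_over C a b <-> same_tp (with_params C a) (with_params C b).
Proof.
split=> [h phi|h]; first by rewrite -[sat _ _]/(tp a C phi) h.
by apply/predeqP => phi; apply: h.
Qed.

(** * Ultrapowers *)

Section Ultrapower.
Variables (L : language) (N : structure L) (J : Type) (U : set (set J)).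
Hypothesis UU : UltraFilter U.

Definition ultra_class (f : J -> N) : set (J -> N) :=
  [set g | U [set j | f j = g j]].

(** Elements are equivalence classes seen as sets of functions, so that equality in the ultrapower
    is plain equality. *)
Definition ultra_carrier : Type := {A | exists f, A = ultra_class f}.

Definition ultra_pi (f : J -> N) : ultra_carrier :=
  exist _ (ultra_class f) (ex_intro _ f erefl).

Lemma ultra_pi_surj (x : ultra_carrier) : exists f, x = ultra_pi f.
Proof.
case: x => A [f Af]; exists f; apply: eq_exist; exact: Af.
Qed.

Definition ultra_repr (x : ultra_carrier) : J -> N :=
  sval (cid (ultra_pi_surj x)).

Lemma ultra_reprK (x : ultra_carrier) : ultra_pi (ultra_repr x) = x.
Proof. by rewrite /ultra_repr; case: cid. Qed.

Lemma ultra_piE (f g : J -> N) :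
  ultra_pi f = ultra_pi g <-> U [set j | f j = g j].
Proof.
split=> [/(congr1 sval) /= fg|fg].
  have : ultra_class g g by apply: (@filterE _ U).
  by rewrite -fg.
apply: eq_exist; apply/predeqP => h; split; apply: filterS2 fg => j /=.
  by move=> ->.
by move=> ->.
Qed.

Definition ultrapower : structure L :=
  @Structure L ultra_carrier
    (let: inhabits x := carrier_inhabited N in inhabits (ultra_pi (fun=> x)))
    (fun f x => ultra_pi (fun j => finterp (fun i => ultra_repr (x i) j)))
    (fun r x => U [set j | rinterp (fun i => ultra_repr (x i) j)]).

Lemma ultra_repr_pi (f : J -> N) : U [set j | ultra_repr (ultra_pi f) j = f j].
Proof. by apply/ultra_piE; rewrite ultra_reprK. Qed.

Lemma tval_ultrapower V (t : term L V) (e : V -> J -> N) :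
  Defs.tval (M := ultrapower) (ultra_pi \o e) t =
  ultra_pi (fun j => Defs.tval (e^~ j) t).
Proof.
elim: t => //= f ts IH; apply/ultra_piE.
have : U [set j | forall i, ultra_repr (ultra_pi
    (fun j => Defs.tval (e^~ j) (ts i))) j = Defs.tval (e^~ j) (ts i)].
  by apply: filter_forall => i; apply: ultra_repr_pi.
apply: filterS => j /= h; congr finterp; apply: funext => i.
by rewrite IH h.
Qed.

Lemma los V (phi : formula L V) (e : V -> J -> N) :
  sat (M := ultrapower) phi (ultra_pi \o e) <->
  U [set j | sat phi (e^~ j)].
Proof.
elim: phi e => {V} [V|V s t|V R ts|V phi1 IH1 phi2 IH2|V phi IH] e /=.
- by split=> //; apply: filter_not_empty.
- by rewrite !tval_ultrapower; apply: ultra_piE.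
- have h : U [set j | (fun i => ultra_repr
      (Defs.tval (M := ultrapower) (ultra_pi \o e) (ts i)) j) =
      (fun i => Defs.tval (e^~ j) (ts i))].
    have : U [set j | forall i, ultra_repr
        (Defs.tval (M := ultrapower) (ultra_pi \o e) (ts i)) j =
        Defs.tval (e^~ j) (ts i)].
      apply: filter_forall => i; rewrite tval_ultrapower.
      exact: ultra_repr_pi.
    by apply: filterS => j ?; apply: funext.
  by split=> h'; apply: filterS2 h h' => j /= ->.
- rewrite IH1 IH2; split=> [h|h h1]; last by apply: filterS2 h h1 => j /=; auto.
  (* An ultrafilter contains the truth set of [phi1] or its complement, on which the implication is
     vacuous. *)
  have [h1|h1] := in_ultra_setVsetC [set j | sat phi1 (e^~ j)] UU.
    by apply: filterS (h h1) => j /=.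
  by apply: filterS h1 => j /=.
- have E f : sat (M := ultrapower) phi (scons (ultra_pi f) (ultra_pi \o e)) <->
      U [set j | sat phi (scons (f j) (e^~ j))].
    have -> : scons (ultra_pi f) (ultra_pi \o e) = ultra_pi \o scons f e.
      by apply: funext => -[].
    rewrite IH; suff -> : (fun j => sat phi ((scons f e)^~ j)) =
      (fun j => sat phi (scons (f j) (e^~ j))) by [].
    apply: funext => j; congr sat; by apply: funext => -[].
  split=> [h|h x]; last first.
    have [f ->] := ultra_pi_surj x.
    by apply/E; apply: filterS h => j; apply.
  have [//|n] := in_ultra_setVsetC
    [set j | forall x, sat phi (scons x (e^~ j))] UU.
  (* Counterexamples chosen index by index form an element of the ultrapower; [x0] fills the indices
     without one. *)
  have H j : exists x, ~ (forall x, sat phi (scons x (e^~ j))) ->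
      ~ sat phi (scons x (e^~ j)).
    have [x0] := carrier_inhabited N.
    have [a|/existsNP[x hx]] := pselect (forall x, sat phi (scons x (e^~ j))).
      by exists x0.
    by exists x.
  have [f hf] := choice H.
  case: (filter_not_empty U).
  by apply: filterS2 n ((E f).1 (h (ultra_pi f))) => j /= /hf.
Qed.

End Ultrapower.

(** * Realizing types by saturation *)

(** At most |L| + aleph_0, which [monster] places strictly below [K]. With formulas as the reference
    set, explicit injections replace cardinal arithmetic. *)
Definition card_small L (X : Type) : Prop :=
  exists f : X -> formula L nat, injective f.

Lemma card_small_inj L X Y (f : X -> Y) : injective f ->
  card_small L Y -> card_small L X.
Proof. by move=> fi [g gi]; exists (g \o f); apply: inj_comp. Qed.

Lemma card_small_surj L X Y (f : X -> Y) : (forall y, exists x, f x = y) ->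
  card_small L X -> card_small L Y.
Proof.
move=> fs; have [g gK] := choice fs.
by apply: (@card_small_inj _ _ _ g) => x y e; rewrite -[x]gK -[y]gK e.
Qed.

Lemma card_small_add L X Y :
  card_small L X -> card_small L Y -> card_small L (X + Y).
Proof.
move=> [f fi] [g gi].
(* The conclusion of the implication, [FFalse] or an equation, records the summand. *)
exists (fun z => match z with
  | inl x => FImp (f x) FFalse
  | inr y => FImp (g y) (FEq (Var L 0) (Var L 0)) end).
by move=> [x|y] [x'|y'] // [] => [/fi->|/gi->].
Qed.

Lemma card_small_nat L : card_small L nat.
Proof. by exists (fun n => FEq (Var L n) (Var L n)) => m n []. Qed.

Lemma card_small_range L (M : Type) X (f : X -> M) :
  card_small L X -> card_small L (range f).
Proof.
apply: (@card_small_surj _ _ _ (fun x => SigSub (mem_set (imageT f x)))).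
move=> [y hy]; have [x _ e] := set_mem hy; exists x; exact: val_inj.
Qed.

Lemma card_small_setU L (M : Type) (A B : set M) :
  card_small L A -> card_small L B -> card_small L (A `|` B).
Proof.
move=> hA hB; have := card_small_add hA hB.
have PA (x : A) : val x \in A `|` B by rewrite inE; left; exact: set_valP.
have PB (x : B) : val x \in A `|` B by rewrite inE; right; exact: set_valP.
apply: (@card_small_surj _ _ _ (fun z => match z with
  | inl x => SigSub (PA x) | inr x => SigSub (PB x) end)).
move=> [x hx]; have [h|h] := set_mem hx.
- by exists (inl (SigSub (mem_set h))); apply: val_inj.
- by exists (inr (SigSub (mem_set h))); apply: val_inj.
Qed.

Lemma card_small_small K L (M : Type) (A : set M) :
  small_type K (formula L nat) -> card_small L A -> small K A.
Proof.
move=> [FK KF] [f fi].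
have AF : (A #<= [set: formula L nat])%card.
  rewrite -(card_le_eql (card_setT A)).
  have /injfunPex[g] : exists2 h : A -> formula L nat, set_fun setT setT h
      & set_inj setT h by exists f => // x y _ _; apply: fi.
  exact: inj_card_le.
by split=> [|KA]; [apply: card_le_trans FK|apply: KF; apply: card_le_trans AF].
Qed.

Lemma card_small_type K L X :
  small_type K (formula L nat) -> card_small L X -> small_type K X.
Proof.
move=> FK hX; apply: (card_small_small FK).
by apply: (card_small_inj _ hX); apply: val_inj.
Qed.

(** The type of [u] over [f], rewritten with parameters from [g], is finitely satisfiable: a finite
    part is one formula, and its existential quantification passes from [f] to [g]. Saturation
    realizes it. *)
Lemma same_tp_extend1 K L (N M : structure L) X (f : X -> N) (g : X -> M)
    (u : N) :
  small_type K (formula L nat) -> saturated K M -> card_small L X ->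
  same_tp f g -> exists y, same_tp (scons u f) (scons y g).
Proof.
move=> FK sM hX fg; pose C := range g.
have [h hh] := choice (fun c : C =>
  let: ex_intro2 x _ e := set_valP c in ex_intro (fun x => g x = val c) x e).
have C_g x : g x \in C by rewrite inE; exists x.
pose p : set (formula L (unit + C)) :=
  [set phi | sat phi (join (fun=> u) (f \o h))].
have [q fq qp|y hy] := sM C p (card_small_small FK (card_small_range g hX)).
  have [psi hpsi] := finite_conj fq.
  pose r (z : unit + C) := if z is inr c then Some c else None.
  have rE (P : structure L) y (e : C -> P) : scons y e \o r = join (fun=> y) e.
    by apply: funext => -[].
  have : sat (FEx (rename r psi)) (f \o h).
    by apply/sat_ex; exists u; apply/sat_rename; rewrite rE; apply/hpsi.
  move/(same_tp_comp h fg) => /sat_ex [y /sat_rename]; rewrite rE => /hpsi hy.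
  exists (fun=> y); split => // phi /hy; rewrite /with_params.
  by have -> : g \o h = (fun c => val c) by apply: funext => c; apply: hh.
exists (y tt) => phi.
pose r (z : option X) : unit + C :=
  if z is Some x then inr (SigSub (C_g x)) else inl tt.
(* The index chosen for the parameter [g x] may differ from [x], but [g] agrees at both, hence so
   does [f]. *)
have -> : scons u f = join (fun=> u) (f \o h) \o r.
  apply: funext => -[x|] //=.
  by apply: (same_tp_eq (same_tp_sym fg)); rewrite hh.
have -> : scons (y tt) g = with_params C y \o r by apply: funext => -[].
rewrite -!sat_rename; split=> [|s]; first exact: hy.
by apply: contrapT => n; apply: (hy (FNot (rename r phi)) n).
Qed.

Lemma same_tp_extend K L (N M : structure L) X (f : X -> N) (g : X -> M)
    (u : nat -> N) :
  small_type K (formula L nat) -> saturated K M -> card_small L X ->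
  same_tp f g -> exists v : nat -> M, same_tp (join u f) (join v g).
Proof.
move=> FK sM hX fg.
(* At stage [n] the tuple [u] is frozen from position [n] on, so every stage is indexed by [nat]. *)
pose P n v := same_tp (join (u \o minn n) f) (join (v : nat -> M) g).
have [v0 P0] : exists v, P 0 v.
  have [y hy] := same_tp_extend1 (u 0) FK sM hX fg.
  exists (fun=> y).
  have E (Q : structure L) x (e : X -> Q) : join (fun=> x) e =
    scons x e \o (fun z : nat + X => if z is inr x then Some x else None).
    by apply: funext => -[].
  rewrite /P; have -> : u \o minn 0 = fun=> u 0.
    by apply: funext => k; rewrite /= min0n.
  by rewrite !E; apply: same_tp_comp.
(* The first [n.+1] entries are kept and the new element fills all later positions. *)
pose S n (v : nat -> M) y := fun k => if k <= n then v k else y.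
have step (nv : nat * (nat -> M)) : exists y,
    P nv.1 nv.2 -> P nv.1.+1 (S nv.1 nv.2 y).
  case: nv => n v /=.
  have [Pn|] := pselect (P n v); last by exists (v 0).
  have [y hy] := same_tp_extend1 (u n.+1) FK sM
    (card_small_add (card_small_nat L) hX) Pn.
  exists y => _; rewrite /P.
  pose r (z : nat + X) : option (nat + X) := match z with
    | inl k => if k <= n then Some (inl k) else None
    | inr x => Some (inr x) end.
  have -> : join (u \o minn n.+1) f =
      scons (u n.+1) (join (u \o minn n) f) \o r.
    apply: funext => -[k|//] /=; case: leqP => kn /=.
      by rewrite !(minn_idPr _) // ltnW.
    by rewrite (minn_idPl _).
  have -> : join (S n v y) g = scons y (join v g) \o r.
    by apply: funext => -[k|//] /=; rewrite /S; case: leqP.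
  exact: same_tp_comp.
have [Y hY] := choice step.
pose V := fix V n := if n is m.+1 then S m (V m) (Y (m, V m)) else v0.
have PV n : P n (V n) by elim: n => [//|n IH]; apply: (hY (n, V n)).
have VE n k : k <= n -> V n k = V k k.
  elim: n => [|n IH]; first by rewrite leqn0 => /eqP->.
  by rewrite leq_eqVlt => /orP[/eqP-> //|kn]; rewrite [LHS]/= /S -ltnS kn IH.
(* The diagonal works because a formula mentions finitely many variables and is settled at one
   stage. *)
exists (fun k => V k k) => phi.
have [A fA hA] := formula_support phi.
have fA' : finite_set (inl @^-1` A) by apply: finite_preimage fA => x y _ _ [].
have [n hn] := finite_bound fA'.
rewrite (hA _ (join u f) (join (u \o minn n) f)); last first.
  by move=> [k|x]; rewrite inE // => /hn /ltnW kn /=; rewrite (minn_idPr _).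
rewrite (hA _ _ (join (V n) g)); first exact: PV.
by move=> [k|x]; rewrite inE // => /hn /ltnW kn /=; rewrite VE.
Qed.

(** * Elementary hulls and coheirs *)

Definition nat_cons T (x : T) (e : nat -> T) (k : nat) : T :=
  if k is l.+1 then e l else x.

Section Hull.
Variables (L : language) (M : structure L) (v : nat -> M).

(** A Skolem function for the failure of a universal formula, with default [v 0]. *)
Definition counterexample (phi : formula L nat) (e : nat -> M) : M :=
  if pselect (exists x, ~ sat phi (nat_cons x e)) is left h then sval (cid h)
  else v 0.

(* Formulas double as codes for Skolem terms, which bounds the cardinality of
   the hull at once: the first component is the element coded by [t], the
   second one the finite list coded by [t], completed by [v 0]. *)
Fixpoint hull_code (t : formula L nat) : M * (nat -> M) :=
  match t with
  | FEq (Var n) _ => (v n, fun=> v 0)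
  | FImp s t => (counterexample s (hull_code t).2,
                 nat_cons (hull_code s).1 (hull_code t).2)
  | _ => (v 0, fun=> v 0)
  end.

Definition hull : set M := range (fun t => (hull_code t).1).

Lemma hull_gen n : hull (v n).
Proof. by exists (FEq (Var L n) (Var L n)). Qed.

Lemma hull_list n (e : nat -> M) : (forall k, hull (e k)) ->
  exists t, forall k, k < n -> (hull_code t).2 k = e k.
Proof.
elim: n e => [|n IH] e he; first by exists FFalse.
have [t ht] := IH (e \o succn) (fun k => he k.+1).
by have [s _ hs] := he 0; exists (FImp s t) => -[|k] //= /ht.
Qed.

(** The Tarski-Vaught test. The finitely many entries of [e] that matter are coded by some [t]; a
    counterexample is then coded by [FImp phi t], so it lies in the hull. *)
Lemma hull_test_nat (phi : formula L nat) (e : nat -> M) :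
  (forall k, hull (e k)) -> (forall x, hull x -> sat phi (nat_cons x e)) ->
  forall x, sat phi (nat_cons x e).
Proof.
move=> he h; apply: contrapT => /existsNP [x hx].
have [A /finite_bound [n hn] hA] := formula_support phi.
have [t ht] := hull_list n he.
have E y : sat phi (nat_cons y e) <-> sat phi (nat_cons y (hull_code t).2).
  apply: hA => -[|k]; rewrite inE // => /hn kn /=.
  by rewrite ht // ltnW.
have [] : ~ sat phi (nat_cons (counterexample phi (hull_code t).2) e).
  rewrite E /counterexample.
  case: pselect => [h'|[]]; first by case: cid.
  by exists x; rewrite -E.
by apply: h; exists (FImp phi t).
Qed.

Lemma hull_test V (phi : formula L (option V)) (e : V -> M) :
  (forall k, hull (e k)) -> (forall x, hull x -> sat phi (scons x e)) ->
  forall x, sat phi (scons x e).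
Proof.
move=> he h.
have [A fA hA] := formula_support phi.
have fB : finite_set (Some @^-1` A) by apply: finite_preimage fA => x y _ _ [].
have [w wi] := finite_inj_nat fB.
have [e' [ee' he']] := extend_along (v 0) e wi.
(* Position 0 is reserved for the quantified variable, hence the shift of the others. *)
pose r (z : option V) := if z is Some y then (w y).+1 else 0.
have E x : sat phi (scons x e) <-> sat (rename r phi) (nat_cons x e').
  rewrite sat_rename; apply: hA => -[y|] //; rewrite inE => Ay /=.
  by apply: ee'; rewrite inE.
move=> x; rewrite E; apply: hull_test_nat => [k|y /h /E //].
by have [->|[y ->]] := he' k; [apply: hull_gen|apply: he].
Qed.

(** The test is applied to the formula saying that the quantified variable differs from the value of
    [f]: were this value outside the hull, it would differ from itself. *)
Lemma hull_closed : Defs.fclosed hull.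
Proof.
move=> f x hx; apply: contrapT => n.
pose phi := FNot (FEq (Var L None) (App (fun i => Var L (Some i)))) :
  formula L (option 'I_(farity f)).
have : forall y, sat phi (scons y x); last by move/(_ (finterp x)); apply.
apply: hull_test => // y hy e; apply: n.
by have <- : y = finterp x := e.
Qed.

Lemma hull_inhabited : inhabited hull.
Proof. exact: (inhabits (SigSub (mem_set (hull_gen 0)))). Qed.

Lemma hull_elementary : elementary_sub hull.
Proof.
exists hull_inhabited, hull_closed.
set S := substructure _ _.
have tE V (t : term L V) (e : V -> S) :
    Defs.tval ((fun x : hull => val x) \o e) t = val (Defs.tval e t : hull).
  elim: t => [//|f ts IH] /=; congr finterp; apply: funext => i.
  by rewrite IH.
suff H V (phi : formula L V) (e : V -> S) :
  sat phi e <-> sat phi ((fun x : hull => val x) \o e).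
  by move=> phi e; apply: H.
elim: phi e => {V} [V|V s t|V R ts|V phi1 IH1 phi2 IH2|V phi IH] e //=.
- by rewrite !tE; split=> [->|/val_inj].
- by under [X in _ <-> rinterp X]funext do rewrite tE.
- by rewrite IH1 IH2.
- have E x : scons (val x) ((fun x : hull => val x) \o e) =
      (fun x : hull => val x) \o scons (x : S) e by apply: funext => -[].
  split=> [h|h x]; last by apply/IH; rewrite -E; apply: h.
  apply: hull_test => [k|x hx]; first exact: set_valP.
  have -> : x = val (SigSub (mem_set hx) : hull) by [].
  by rewrite E; apply/IH.
Qed.

Lemma hull_small : card_small L hull.
Proof. by apply: card_small_range; exists id. Qed.

End Hull.

(** The limit type is the type of the class of [A] in the ultrapower over the diagonal image of [g];
    saturation brings it back to [M]. *)
Lemma same_tp_limit K L (M : structure L) X (g : X -> M) (A : nat -> nat -> M)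
    (U : set (set nat)) : UltraFilter U ->
  small_type K (formula L nat) -> saturated K M -> card_small L X ->
  exists b : nat -> M, forall phi : formula L (nat + X),
    sat phi (join b g) <-> U [set i | sat phi (join (A i) g)].
Proof.
move=> UU FK sM hX.
pose f x : ultrapower M U := ultra_pi U (fun=> g x).
pose u k : ultrapower M U := ultra_pi U (fun i => A i k).
have fg : same_tp f g.
  move=> phi; apply: iff_trans (los UU phi (fun x _ => g x)) _.
  by split=> [/filter_const //|h]; apply: filterE.
have [b hb] := same_tp_extend u FK sM hX fg; exists b => phi.
rewrite -(hb phi).
have -> : join u f = ultra_pi U \o (join (fun k i => A i k) (fun x _ => g x)).
  by apply: funext => -[].
rewrite (los UU); suff -> : (fun i => sat phi
    ((join (fun k i => A i k) (fun x _ => g x))^~ i)) =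
  (fun i => sat phi (join (A i) g)) by [].
by apply: funext => i; congr sat; apply: funext => -[].
Qed.

Definition params (T : Type) (E : set T) (c : E) : T := val c.
Arguments params {T} E c.

(** One formula replaces a finite set of them, and parameters are named by indices of [b] instead of
    elements of its range, so that [same_tp] applies. *)
Lemma ind_uP L (M : structure L) (E : set M) I J (a : I -> M) (b : J -> M) :
  ind_u E a b <-> forall phi : formula L (I + (J + E)),
    sat phi (join a (join b (params E))) ->
    exists e : I -> M,
      (forall i, E (e i)) /\ sat phi (join e (join b (params E))).
Proof.
split=> [h phi hphi|h q fq qp].
  have bP j : b j \in range b `|` E by rewrite inE; left; exists j.
  have EP (c : E) : val c \in range b `|` E.
    by rewrite inE; right; apply: set_valP.
  pose r (z : I + (J + E)) : I + (range b `|` E) := match z with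
    | inl i => inl i
    | inr (inl j) => inr (SigSub (bP j))
    | inr (inr c) => inr (SigSub (EP c)) end.
  have rE e : join e (join b (params E)) = with_params (range b `|` E) e \o r.
    by apply: funext => -[i|[j|c]].
  have [|e [eE he]] := h [set rename r phi] (finite_set1 _).
    by move=> _ -> /=; rewrite /tp /= sat_rename -rE.
  by exists e; split=> //; rewrite rE -sat_rename; apply: he.
have H (c : (range b `|` E : set M)) :
    exists z : J + E, val c = join b (params E) z.
  have [[j _ e]|cE] := set_valP c; first by exists (inl j).
  by exists (inr (SigSub (mem_set cE))).
have [s hs] := choice H.
pose r (z : I + (range b `|` E)) : I + (J + E) :=
  match z with inl i => inl i | inr c => inr (s c) end.
have rE e : with_params (range b `|` E) e = join e (join b (params E)) \o r.
  by apply: funext => -[i|c] //=; apply: hs.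
have [psi hpsi] := finite_conj fq.
have [|e [eE he]] := h (rename r psi).
  by apply/sat_rename; rewrite -rE; apply/hpsi => phi /qp.
exists e; split=> //; apply/hpsi; rewrite rE.
exact/sat_rename.
Qed.

(** The witnesses found for [a] and [b] lie in [E], so they can be named as parameters, and what
    holds of them and [b] transfers to [b']. *)
Lemma ind_u_same_tp L (M : structure L) (E : set M) I J (a a' : I -> M)
    (b b' : J -> M) :
  same_tp (join a (join b (params E))) (join a' (join b' (params E))) ->
  ind_u E a b -> ind_u E a' b'.
Proof.
move=> h /ind_uP ab; apply/ind_uP => phi /h /ab [e [eE he]].
exists e; split=> //.
pose r (z : I + (J + E)) : I + (J + E) := match z with
  | inl i => inr (inr (SigSub (mem_set (eE i))))
  | inr y => inr y end.
have rE x y : join e (join y (params E)) =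
    join (x : I -> M) (join (y : J -> M) (params E)) \o r.
  by apply: funext => -[i|[j|c]].
by rewrite (rE a') -sat_rename -h sat_rename -rE.
Qed.

(* The limit type of [A] along an ultrafilter refining the order of [nat] is
   realized by [b0] over [E], then by [b1] over [E] and [b0]; since [A i]
   precedes almost all [A j], the realizations come out in reverse order. *)
Lemma coheir_pair K L (M : structure L) (A : nat -> nat -> M)
    (psi : formula L (nat + nat)) :
  small_type K (formula L nat) -> saturated K M ->
  (forall i j, i < j -> sat psi (join (A i) (A j))) ->
  exists (E : set M) (b0 b1 : nat -> M),
    [/\ card_small L E, elementary_sub E,
        same_tp (join b0 (params E)) (join b1 (params E)),
        ind_u E b1 b0 & sat psi (join b1 b0)].
Proof.
move=> FK sM hA.
(* An enumeration of all entries of all the tuples [A i], which puts them in the hull. *)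
pose v n := if unpickle n is Some ij then A ij.1 ij.2 else A 0 0.
pose E := hull v.
have EA i k : E (A i k).
  by have := hull_gen v (pickle (i, k)); rewrite /v pickleK.
have sE : card_small L E by apply: hull_small.
have [U [UU ooU]] := ultraFilterLemma eventually_filter.
have [b0 hb0] := same_tp_limit (params E) A UU FK sM sE.
have [b1 hb1] := same_tp_limit (join b0 (params E)) A UU FK sM
  (card_small_add (card_small_nat L) sE).
exists E, b0, b1; split => //.
- exact: hull_elementary.
(* The limit type over [E] and [b0], realized by [b1], restricts over [E] to the one realized by
   [b0]. *)
- move=> phi; rewrite hb0.
  pose r (z : nat + E) : nat + (nat + E) :=
    match z with inl k => inl k | inr c => inr (inr c) end.
  have rE x : join x (params E) = join x (join b0 (params E)) \o r.
    by apply: funext => -[].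
  rewrite rE -sat_rename hb1.
  suff -> : (fun i => sat (rename r phi) (join (A i) (join b0 (params E)))) =
     (fun i => sat phi (join (A i) (params E))) by [].
  by apply: funext => i; rewrite (rE (A i)); apply: propext; apply: sat_rename.
(* A formula true of [b1] holds of some [A i], whose entries lie in [E]. *)
- apply/ind_uP => phi /hb1 /filter_ex [i hi].
  exists (A i); split=> [k|].
    exact: EA.
  exact: hi.
(* For fixed [i], the limit over [j > i] gives [psi] between [A i] and [b0]; the limit over [i] then
   replaces [A i] by [b1]. *)
- have Ab i : sat psi (join (A i) b0).
    pose r (z : nat + nat) : nat + E := match z with
      | inl k => inr (SigSub (mem_set (EA i k))) | inr k => inl k end.
    have rE x : join (A i) x = join x (params E) \o r by apply: funext => -[].
    rewrite rE -sat_rename hb0; apply: ooU; exists i.+1 => // j ij.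
    by rewrite /= sat_rename -rE; apply: hA.
  pose r (z : nat + nat) : nat + (nat + E) := match z with
      | inl k => inl k | inr k => inr (inl k) end.
  have rE x : join x b0 = join x (join b0 (params E)) \o r.
    by apply: funext => -[].
  rewrite rE -sat_rename hb1; apply: filterE => i.
  by rewrite /= sat_rename -rE.
Qed.

(** * The 4-cycle *)

Lemma same_tp_swap L (N N' : structure L) I J X (a : I -> N) (b : J -> N)
    (g : X -> N) (a' : I -> N') (b' : J -> N') (g' : X -> N') :
  same_tp (join a (join b g)) (join a' (join b' g')) ->
  same_tp (join b (join a g)) (join b' (join a' g')).
Proof.
pose r (z : J + (I + X)) : I + (J + X) := match z with
  | inl k => inr (inl k)
  | inr (inl k) => inl k
  | inr (inr c) => inr (inr c) end.
have rE (P : structure L) u v w : join v (join u w) =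
    join (u : I -> P) (join (v : J -> P) (w : X -> P)) \o r.
  by apply: funext => -[|[]].
by rewrite !rE; apply: same_tp_comp.
Qed.

Lemma equiv_over_join L (M : structure L) (E : set M) I J (c c' : I -> M)
    (x : J -> M) : equiv_over (E `|` range x) c c' ->
  same_tp (join c (join x (params E))) (join c' (join x (params E))).
Proof.
move=> /equiv_overP; set C := E `|` range x.
have xP j : x j \in C by rewrite inE; right; exists j.
have EP (e : E) : val e \in C by rewrite inE; left; apply: set_valP.
pose r (z : I + (J + E)) : I + C := match z with
  | inl i => inl i
  | inr (inl j) => inr (SigSub (xP j))
  | inr (inr e) => inr (SigSub (EP e)) end.
have rE y : join y (join x (params E)) = with_params C y \o r.
  by apply: funext => -[i|[j|e]].
by rewrite !rE; apply: same_tp_comp.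
Qed.

Section Cycle.
Variables (K : Type) (L : language) (M : structure L).
Variable ind : ternary_relation M.
Hypotheses (FK : small_type K (formula L nat)) (sM : saturated K M).
Variables (E : set M) (b0 b1 : nat -> M) (psi : formula L (nat + nat)).
Hypothesis sE : card_small L E.
Hypothesis b01 : same_tp (join b0 (params E)) (join b1 (params E)).

(** The arrow from [x] to [y]; [psi] and u-independence run against it, from [y] to [x]. *)
Let like (x y : nat -> M) : Prop :=
  same_tp (join b0 (join b1 (params E))) (join x (join y (params E))).

Let like_l x y : like x y -> same_tp (join b0 (params E)) (join x (params E)).
Proof.
pose r (z : nat + E) : nat + (nat + E) :=
  match z with inl k => inl k | inr c => inr (inr c) end.
have rE u v : join u (params E) = join (u : nat -> M) (join v (params E)) \o r.
  by apply: funext => -[].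
by rewrite (rE b0 b1) (rE x y); apply: same_tp_comp.
Qed.

Let like_r x y : like x y -> same_tp (join b1 (params E)) (join y (params E)).
Proof. exact: (same_tp_comp inr). Qed.

Let like_same_tp x y x' y' : like x y ->
  same_tp (join x (join y (params E))) (join x' (join y' (params E))) ->
  like x' y'.
Proof. exact: same_tp_trans. Qed.

Let like_ind_u x y : ind_u E b1 b0 -> like x y -> ind_u E y x.
Proof.
by move=> h xy; apply: ind_u_same_tp h; apply: same_tp_swap.
Qed.

Let like_psi x y : sat psi (join b1 b0) -> like x y -> sat psi (join y x).
Proof.
pose r (z : nat + nat) : nat + (nat + E) :=
  match z with inl k => inr (inl k) | inr k => inl k end.
have rE u v : join v u = join u (join v (params E)) \o r.
  by apply: funext => -[].
by move=> h xy; move: h; rewrite !rE -!sat_rename => /xy.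
Qed.

Let like_extr x : same_tp (join b0 (params E)) (join x (params E)) ->
  exists y, like x y.
Proof.
move=> /(same_tp_extend b1 FK sM (card_small_add (card_small_nat L) sE)) [y hy].
by exists y; apply: same_tp_swap.
Qed.

Let like_extl y : same_tp (join b1 (params E)) (join y (params E)) ->
  exists x, like x y.
Proof.
by move=> /(same_tp_extend b0 FK sM (card_small_add (card_small_nat L) sE)).
Qed.

Lemma four_cycle : elementary_sub E -> ind_u E b1 b0 -> sat psi (join b1 b0) ->
  full_existence K ind -> weak_transitivity K ind -> weak_independence K ind ->
  exists a c b d : nat -> M, [/\ sat psi (join a c), sat psi (join c b),
    sat psi (join b d) & sat psi (join d a)].
Proof.
move=> eE uE hpsi fex wtr wind.
have sN : small_type K nat := card_small_type FK (card_small_nat L).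
have sE' : small K E := card_small_small FK sE.
have sEd : small K (E `|` range b1).
  apply: (card_small_small FK); apply: card_small_setU => //.
  exact: card_small_range (card_small_nat L).
(* The tuple [b1] itself serves as the base point [d] of weak transitivity. *)
have [b db] := like_extr b01.
have [a [ab0 iab]] := fex _ _ b0 _ b sN sN sEd.
have ad : like a b1.
  by apply: same_tp_sym; apply: equiv_over_join.
(* The arrow [a -> b1] makes [b1] u-independent from [a], which is the required h-independence;
   [b1 -> b] makes [b] u-independent from [b1]. *)
have iaEb : ind a E b.
  by apply: (wtr E _ _ _ a b b1) => //; apply: like_ind_u.
have [c1 c1a] : exists c1, like c1 a.
  by apply: like_extl; apply: same_tp_trans (same_tp_sym b01) (like_l ad).
have [c2 bc2] : exists c2, like b c2.
  by apply: like_extr; apply: same_tp_trans b01 (like_r db).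
have [c [ca cb]] : exists c,
    equiv_over (E `|` range a) c c1 /\ equiv_over (E `|` range b) c c2.
  apply: (wind E _ _ _ c1 c2 a b) => //.
  - apply/equiv_overP.
    apply: same_tp_trans (same_tp_sym (like_l c1a)) _.
    exact: same_tp_trans b01 (like_r bc2).
  - exact: like_ind_u.
  - exact: like_ind_u.
(* The arrows [a -> b1 -> b -> c -> a], read backwards, give the four instances of [psi]. *)
exists a, c, b, b1; split; apply: like_psi => //.
- by apply: like_same_tp c1a _; apply: same_tp_sym; apply: equiv_over_join.
- apply: like_same_tp bc2 _; apply: same_tp_swap.
  by apply: same_tp_sym; apply: equiv_over_join.
Qed.

End Cycle.

(** * Compactness for cycles, and the theorem *)

(** If every finite part of [p] had a cycle in [M], these cycles would give one for [p] in an
    ultrapower of [M], along an ultrafilter containing, for each finite part [q0], the set of finite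
    parts above [q0]. *)
Lemma cycle_compactness L (T : set (sentence L)) (M : structure L) n I
    (p : set (formula L (I + I))) : models M T ->
  ~ (exists (N : structure L) (b : 'I_n -> I -> N),
      models N T /\ forall i, realizes p (b i) (b (ordS i))) ->
  exists2 q, finite_set q /\ q `<=` p &
    ~ exists b : 'I_n -> I -> M, forall i, realizes q (b i) (b (ordS i)).
Proof.
move=> MT; apply: contra_notP => /forall2NP H.
have [x0] := carrier_inhabited M.
(* A constant family serves where [q] is not a finite part of [p]. *)
have {}H q : exists b : 'I_n -> I -> M, finite_set q /\ q `<=` p ->
    forall i, realizes q (b i) (b (ordS i)).
  by have [?|/contrapT[b hb]] := H q; [exists (fun _ _ => x0)|exists b].
have [b hb] := choice H.
pose D := [set q : set (formula L (I + I)) | finite_set q /\ q `<=` p].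
have FF : ProperFilter (filter_from D (fun q0 => [set q | D q /\ q0 `<=` q])).
  apply: filter_from_proper; last by move=> q Dq; exists q; split.
  apply: filter_from_filter; first by exists set0; split.
  move=> q q' [fq qp] [fq' qp']; exists (q `|` q').
    by split; [rewrite finite_setU|rewrite subUset].
  by move=> r [Dr]; rewrite subUset => -[? ?]; split; split.
have [U [UU FU]] := ultraFilterLemma FF.
exists (ultrapower M U), (fun i x => ultra_pi U (fun q => b q i x)); split.
  move=> phi Tphi.
  have -> : of_void (ultrapower M U) = ultra_pi U \o of_void _.
    by apply: funext => -[].
  apply/los; apply: filterE => q /=.
  have -> : (of_void _)^~ q = of_void M by apply: funext => -[].
  exact: MT.
move=> i phi pphi.
have -> : join (fun x => ultra_pi U (fun q => b q i x))
    (fun x => ultra_pi U (fun q => b q (ordS i) x)) =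
  ultra_pi U \o (join (fun x q => b q i x) (fun x q => b q (ordS i) x)).
  by apply: funext => -[].
apply/los; apply: FU; exists [set phi].
  by split; [exact: finite_set1|move=> _ ->].
move=> q [Dq /(_ phi erefl) qphi] /=.
have -> : (join (fun x q => b q i x) (fun x q => b q (ordS i) x))^~ q =
  join (b q i) (b q (ordS i)) by apply: funext => -[].
exact: hb.
Qed.

(** Elementary equivalence is put as equality of types of the empty tuple, from which
    [same_tp_extend] can start. *)
Lemma complete_same_tp L (T : set (sentence L)) (N M : structure L) :
  complete_theory T -> models N T -> models M T ->
  same_tp (of_void N) (of_void M).
Proof.
move=> [_ cT] NT MT phi; have [h|h] := cT phi.
  by split=> _; apply: h.
by split=> hphi; [case: (h _ NT hphi)|case: (h _ MT hphi)].
Qed.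

Theorem theorem4p28 (L : language) (T : set (sentence L)) (K : Type)
    (MM : structure L) (ind : ternary_relation MM) :
  complete_theory T -> models MM T -> monster K MM ->
  invariant_rel K ind -> symmetry K ind -> full_existence K ind ->
  weak_transitivity K ind -> weak_independence K ind ->
  NSOP 4 T.
Proof.
move=> cT MT [FK sM _] _ _ fex wtr wind [I [p [N [a [NT _ ap ncyc]]]]].
have [q [fq qp]] := cycle_compactness MT ncyc; apply.
have [psi0 hpsi0] := finite_conj fq.
have [A fA hA] := formula_support psi0.
(* Only the variables that [psi0] uses on either side matter; [w] numbers them, and tuples become
   indexed by [nat]. *)
have fB : finite_set (inl @^-1` A `|` inr @^-1` A).
  by rewrite finite_setU; split; apply: finite_preimage fA => x y _ _ [].
have [w wi] := finite_inj_nat fB.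
have [x0] := carrier_inhabited N.
have [a' ha'] := choice (fun i => extend_along x0 (a i) wi).
pose r (z : I + I) : nat + nat :=
  match z with inl x => inl (w x) | inr x => inr (w x) end.
have rE (P : structure L) (x y : nat -> P) :
    join x y \o r = join (x \o w) (y \o w).
  by apply: funext => -[].
have ha'' i j : i < j -> sat (rename r psi0) (join (a' i) (a' j)).
  move=> ij; apply/sat_rename; rewrite rE.
  apply/(hA N _ (join (a i) (a j))).
    move=> [x|x]; rewrite inE => Ax /=; symmetry.
      by apply: (ha' i).1; rewrite inE; left.
    by apply: (ha' j).1; rewrite inE; right.
  by apply/hpsi0 => phi /qp; apply: (ap i j).2.
(* The whole sequence is packed into one tuple, moved at once from [N] to [MM]. *)
pose u n := if unpickle n is Some ij then a' ij.1 ij.2 else x0.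
have void_small : card_small L void by exists (of_void _) => -[].
have [v hv] := same_tp_extend u FK sM void_small (complete_same_tp cT NT MT).
have hv' i j : i < j -> sat (rename r psi0)
    (join (fun k => v (pickle (i, k))) (fun k => v (pickle (j, k)))).
  move=> ij.
  pose s (z : nat + nat) : nat + void :=
    match z with
    | inl k => inl (pickle (i, k))
    | inr k => inl (pickle (j, k)) end.
  have -> : join (fun k => v (pickle (i, k))) (fun k => v (pickle (j, k))) =
    join v (of_void MM) \o s by apply: funext => -[].
  rewrite -(same_tp_comp s hv).
  have -> : join u (of_void N) \o s = join (a' i) (a' j).
    by apply: funext => -[k|k]; rewrite /= /u pickleK.
  exact: ha''.
have [E [b0 [b1 [sE eE b01 uE hpsi]]]] := coheir_pair FK sM hv'.
have [c0 [c1 [c2 [c3 [h0 h1 h2 h3]]]]] :=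
  four_cycle FK sM sE b01 eE uE hpsi fex wtr wind.
(* Composition with [w] returns from tuples indexed by [nat] to tuples indexed by [I]. *)
have cyc x y : sat (rename r psi0) (join x y) -> realizes q (x \o w) (y \o w).
  by move=> /sat_rename; rewrite rE => /hpsi0.
exists (fun i : 'I_4 => nth c0 [:: c0; c1; c2; c3] i \o w).
by move=> [[|[|[|[|//]]]] i]; apply: cyc.
Qed.
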